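(* Let $X$ be a real Hilbert space, let $M>0$, and let $B(M)=\{v\in X:\|v\|_X<M\}$, with closure $\overline{B(M)}$. Let $J:X\to\mathbb{R}$ be Fréchet differentiable on $X$, with derivative at $v$ identified with $J'(v)\in X$ via the Riesz representation theorem. Assume that there are constants $L>0$ and $\Lambda>0$ such that $$\|J'(v_2)-J'(v_1)\|_X\le L\|v_2-v_1\|_X\quad\text{for all } v_1,v_2\in\overline{B(M)},$$ $$\langle J'(v_1)-J'(v_2),v_1-v_2\rangle_X\ge\Lambda\|v_1-v_2\|_X^2\quad\text{for all } v_1,v_2\in\overline{B(M)}.$$ Let $v_{\min}$ be the unique minimizer of $J$ on $\overline{B(M)}$ (which exists under these hypotheses), and suppose that $v_{\min}$ belongs to the interior $B(M)$. Fix $v^{(0)}\in B(M)$ and assume that the ball centered at $v_{\min}$ of radius $\|v^{(0)}-v_{\min}\|_X$ is contained in $B(M)$: $$B\big(v_{\min},\|v^{(0)}-v_{\min}\|_X\big)\subset B(M).$$ Let $\eta_0=\min(2\Lambda/L^2,1)$, fix $\eta\in(0,\eta_0)$, and define $$v^{(m+1)}=v^{(m)}-\eta J'(v^{(m)}),\qquad m\ge 0.$$ Then there exists a number $q\in(0,1)$ such that $$v^{(m)}\in B(M)\quad\text{and}\quad\|v^{(m)}-v_{\min}\|_X\le q^{m-1}\|v^{(0)}-v_{\min}\|_X\quad\text{for all } m\ge 1.$$ As a result, the sequence $v^{(m)}$ converges to $v_{\min}$ in $X$ as $m\to\infty$.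
   Context: For a Fréchet differentiable functional $J:X\to\mathbb{R}$ on a real Hilbert space $X$, the element $J'(v)\in X$ is the Riesz representative of the Fréchet derivative $DJ(v)$, i.e. $DJ(v)(h)=\langle J'(v),h\rangle_X$ for all $h\in X$. For $w\in X$ and $r\ge 0$, $B(w,r)$ denotes the open ball $\{v\in X:\|v-w\|_X<r\}$. *)

(* Defs.v *)
From HB Require Import structures.
From mathcomp Require Import all_boot all_order all_algebra.
From mathcomp Require Import all_classical all_reals all_analysis.

Set Implicit Arguments.
Unset Strict Implicit.
Unset Printing Implicit Defensive.

Import Order.TTheory GRing.Theory Num.Theory.
Import numFieldNormedType.Exports.

Local Open Scope classical_set_scope.
Local Open Scope ring_scope.

(* For [theta = idfun] the forms of type [{dot X for theta}] are the symmetric,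
   bilinear, positive definite ones. *)
HB.mixin Record CompleteNormedModule_isHilbert (R : realType) X
    of CompleteNormedModule R X := {
  inner : {dot X for @idfun R};
  sqr_normE : forall x : X, `|x| ^+ 2 = inner x x
}.

#[short(type="hilbertType")]
HB.structure Definition Hilbert (R : realType) :=
  {X of CompleteNormedModule R X & CompleteNormedModule_isHilbert R X}.

Definition riesz_derivative (R : realType) (X : hilbertType R)
    (J : X -> R) (J' : X -> X) : Prop :=
  forall v : X, differentiable J v /\ forall h : X, 'd J v h = inner (J' v) h.

Definition minimizer_on (R : realType) (X : hilbertType R)
    (A : set X) (J : X -> R) (v : X) : Prop :=
  A v /\ forall w : X, A w -> J v <= J w.

(* Main.v *)
Require Import Defs.
From HB Require Import structures.
From mathcomp Require Import all_boot all_order all_algebra.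
From mathcomp Require Import all_classical all_reals all_analysis.

From mathcomp Require Import ring lra.

(** Why the theorem is true.

Existence and uniqueness of the minimizer.  Along a segment from [v] to [w]
the derivative of [J] is the pairing of [J'] with [w - v], and strong
monotonicity of [J'] makes this derivative grow at least at the rate
[Lambda * `|w - v| ^+ 2].  By the mean value theorem [J] therefore lies above
its tangent at [v] by at least [Lambda / 2 * `|w - v| ^+ 2]
([monotone_gradient_lower_bound]).  Applied at the midpoint of two points, this
says that the midpoint improves on the average value of [J] by a multiple of
their squared distance; hence two nearly optimal points are close to each
other, minimizing sequences are Cauchy, and their limit is the only minimizer
([strongly_midconvex_minimizer]).  Applied at one fixed point, it bounds [J]
from below, so that the infimum is finite.

Convergence of the iteration.  The minimizer is interior, so the gradient
vanishes there ([interior_minimizer_critical]) and it is a fixed point of the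
step [v - eta *: J' v].  Expanding the square, one step multiplies the squared
distance to the minimizer by at most
[k = 1 - 2 * eta * Lambda + eta ^+ 2 * L ^+ 2]
([gradient_step_contraction]), and [k < 1] is exactly the condition
[eta < 2 * Lambda / L ^+ 2].  The hypotheses on [J'] are only available in the
ball of radius [M], so the bound and the membership in that ball are proved by
the same induction: a point strictly closer to the minimizer than the initial
one lies in the ball around the minimizer that is assumed to fit inside. *)

Set Implicit Arguments.
Unset Strict Implicit.
Unset Printing Implicit Defensive.

Import Order.TTheory GRing.Theory Num.Theory.
Import numFieldNormedType.Exports.

Local Open Scope classical_set_scope.
Local Open Scope ring_scope.

(** * Inner product identities *)

Lemma inner_sym (R : realType) (X : hilbertType R) (x y : X) :
  inner x y = inner y x.
Proof. by rewrite (hermC (inner : {dot X for _})) expr0 mul1r. Qed.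

Lemma innerZr (R : realType) (X : hilbertType R) (a : R) (x y : X) :
  inner x (a *: y) = a * inner x y.
Proof. exact: linearZr_LR. Qed.

Lemma sqr_normD (R : realType) (X : hilbertType R) (x y : X) :
  `|x + y| ^+ 2 = `|x| ^+ 2 + 2 * inner x y + `|y| ^+ 2.
Proof.
rewrite !sqr_normE linearDl /= !linearDr /= (inner_sym y x).
by ring.
Qed.

(** Expanding the nonnegative square [`|x + c *: y| ^+ 2].  The weight [c] is
there to absorb a linear term into a quadratic one of prescribed size. *)
Lemma inner_ge_young (R : realType) (X : hilbertType R) (c : R) (x y : X) :
  0 < c -> - (`|x| ^+ 2 / c + c * `|y| ^+ 2) <= 2 * inner x y.
Proof.
move=> c0; have := sqr_ge0 `|x + c *: y|.
rewrite sqr_normD innerZr normrZ exprMn gtr0_norm // => sq.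
rewrite -(ler_pM2l c0) -subr_ge0; apply: le_trans sq _.
by rewrite le_eqVlt; apply/orP; left; apply/eqP; field; rewrite gt_eqF.
Qed.

(** * Strong convexity along segments *)

(** The chain rule along a line: it reduces statements about [J] on segments to
one-variable calculus. *)
Lemma riesz_is_derive_line (R : realType) (X : hilbertType R)
    (J : X -> R) (J' : X -> X) (v h : X) (t : R) :
  riesz_derivative J J' ->
  is_derive t 1 (fun s : R => J (v + s *: h)) (inner (J' (v + t *: h)) h).
Proof.
move=> hJ; have [dJ gradJ] := hJ (v + t *: h).
have line : is_diff t (fun s : R => v + s *: h) ( *:%R^~ h).
  by apply: is_diff_eq; rewrite add0r.
have dJl : is_diff (v + t *: h) J ('d J (v + t *: h)) by exact: differentiableP.
have cmp : is_diff t (J \o (fun s : R => v + s *: h)) _ := is_diff_comp line dJl.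
apply: DeriveDef.
  by apply: diff_derivable; case: cmp.
by rewrite deriveE ?diff_val /= ?scale1r ?gradJ.
Qed.

(** Convexity, parametrized by [v + t *: (w - v)] because these are the lines
along which [J] is differentiated. *)
Definition segment_closed (R : realType) (X : hilbertType R) (A : set X) : Prop :=
  forall (v w : X) (t : R), A v -> A w -> 0 <= t <= 1 -> A (v + t *: (w - v)).

(** Strong convexity from a strongly monotone gradient.  Subtracting
[c / 2 * t ^+ 2] from [J] on the segment, with [c = Lambda * `|w - v| ^+ 2],
leaves a function whose derivative is everywhere at least its value at [0], by
monotonicity; a single application of the mean value theorem then replaces
integration along the segment. *)
Lemma monotone_gradient_lower_bound (R : realType) (X : hilbertType R)
    (A : set X) (J : X -> R) (J' : X -> X) (Lambda : R) (v w : X) :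
  riesz_derivative J J' -> segment_closed A ->
  (forall v1 v2 : X, A v1 -> A v2 ->
    Lambda * `|v1 - v2| ^+ 2 <= inner (J' v1 - J' v2) (v1 - v2)) ->
  A v -> A w ->
  J v + inner (J' v) (w - v) + Lambda / 2 * `|w - v| ^+ 2 <= J w.
Proof.
move=> hJ convA mono Av Aw.
pose c := Lambda * `|w - v| ^+ 2.
pose g (t : R) : R := J (v + t *: (w - v)) - (c / 2) *: t ^+ 2.
pose dg (t : R) : R := inner (J' (v + t *: (w - v))) (w - v) - c * t.
have g_derive (t : R) : is_derive t 1 g (dg t).
  have ? := riesz_is_derive_line v (w - v) t hJ.
  apply: is_derive_eq; rewrite /dg /GRing.scale /=; lra.
have g_cont : {within `[0, 1], continuous g}.
  apply: derivable_within_continuous => t _.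
  by case: (g_derive t).
have [t t01] := MVT ltr01 (fun t _ => g_derive t) g_cont.
rewrite /g scale1r scale0r addr0 (addrC v) subrK expr1n expr0n /= subr0 mulr1.
rewrite /GRing.scale /= mulr1 mulr0 subr0 /dg => gE.
move: t01; rewrite in_itv /= => /andP[t0 t1].
have Avt : A (v + t *: (w - v)) by apply: convA; rewrite // !ltW.
(* Both sides of the monotonicity inequality between [v + t *: (w - v)] and
   [v] carry a factor [t], which is cancelled since the mean value point is
   interior. *)
have := mono _ _ Avt Av; rewrite addrAC subrr add0r normrZ (ger0_norm (ltW t0)).
rewrite innerZr linearBl /= exprMn mulrCA expr2 -[t * t * _]mulrA.
rewrite ler_pM2l // => slope.
by rewrite /c in gE *; lra.
Qed.

(** * Existence and uniqueness of the minimizer *)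

(** With [m] the infimum of [J], the midpoint inequality gives
[k * `|v - w| ^+ 2 <= (J v + J w) / 2 - m]: near-minimizers are close together.
This yields the Cauchy property of a minimizing sequence, and uniqueness when
both values equal [m].  The point [z] stands for the midpoint. *)
Lemma strongly_midconvex_minimizer (R : realType) (X : hilbertType R)
    (A : set X) (J : X -> R) (k b : R) :
  closed A -> A !=set0 -> continuous J -> 0 < k ->
  (forall v, A v -> b <= J v) ->
  (forall v w, A v -> A w -> exists2 z, A z &
     J z + k * `|v - w| ^+ 2 <= (J v + J w) / 2) ->
  exists! v : X, minimizer_on A J v.
Proof.
move=> clA [v0 Av0] cJ k0 Jb mid.
pose m := inf (J @` A).
have Jhas : has_inf (J @` A).
  split; first by exists (J v0), v0.
  by exists b => _ [v Av <-]; exact: Jb.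
have Jm v : A v -> m <= J v.
  by move=> Av; apply: ge_inf; [case: Jhas | exists v].
have gap v w : A v -> A w -> k * `|v - w| ^+ 2 <= (J v + J w) / 2 - m.
  by move=> Av Aw; have [z /Jm ? ?] := mid _ _ Av Aw; lra.
have /choice[u uP] : forall n : nat, exists v, A v /\ J v < m + n.+1%:R^-1.
  move=> n; have e0 : 0 < n.+1%:R^-1 :> R by rewrite invr_gt0.
  by have [_ [v Av <-] Jv] := inf_adherent e0 Jhas; exists v.
have uA n : A (u n) by case: (uP n).
have u_cvg : cvg (u @ \oo).
  apply/cauchy_cvgP/cauchy_exP => e e0.
  have ke0 : 0 < k * e ^+ 2 by rewrite mulr_gt0 ?exprn_gt0.
  have [N _ small] := near_infty_natSinv_lt (PosNum ke0).
  exists (u N), N => // n /= Nn.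
  rewrite -ball_normE /= -(ltr_pXn2r (n:=2)) ?nnegrE ?(ltW e0) //.
  rewrite -(ltr_pM2l k0).
  have Ju p : (N <= p)%N -> J (u p) < m + k * e ^+ 2.
    move=> Np; have [_ Jp] := uP p; apply: lt_trans Jp _.
    by rewrite ltrD2l; exact: small Np.
  have := gap _ _ (uA N) (uA n); have := Ju N (leqnn N); have := Ju n Nn; lra.
pose v := lim (u @ \oo).
have Av : A v by apply: (closed_cvg A clA _ v u_cvg); exact: nearW.
have Jv_le : J v <= m.
  have Ju : J \o u @ \oo --> J v by apply: continuous_cvg => //; exact: cJ.
  apply/ler_addgt0Pr => e e0.
  rewrite -(cvg_lim (@Rhausdorff R) Ju); apply: limr_le; first exact: cvgP Ju.
  near=> n; have [_ /ltW/le_trans] := uP n; apply; rewrite lerD2l ltW //=.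
  by near: n; exact: (near_infty_natSinv_lt (PosNum e0)).
exists v; split => [|w [Aw wmin]].
  by split=> // w Aw; exact: le_trans Jv_le (Jm _ Aw).
have := gap _ _ Av Aw; have := wmin _ Av => Jwv gap_vw.
have : k * `|v - w| ^+ 2 <= 0 by lra.
rewrite pmulr_rle0 // => sq_le0; apply/eqP; rewrite -subr_eq0 -normr_eq0.
by rewrite -sqrf_eq0 eq_le sq_le0 sqr_ge0.
Unshelve. all: by end_near. Qed.

(** The lower bound on [J] comes from the quadratic growth at a fixed point [a],
the linear term being absorbed by Young's inequality with weight [Lambda];
the midpoint inequality is the average of the two growth inequalities at the
midpoint, where the linear terms are opposite and cancel. *)
Lemma strongly_monotone_minimizer (R : realType) (X : hilbertType R)
    (A : set X) (J : X -> R) (J' : X -> X) (Lambda : R) :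
  riesz_derivative J J' -> closed A -> A !=set0 -> segment_closed A ->
  0 < Lambda ->
  (forall v1 v2 : X, A v1 -> A v2 ->
    Lambda * `|v1 - v2| ^+ 2 <= inner (J' v1 - J' v2) (v1 - v2)) ->
  exists! v : X, minimizer_on A J v.
Proof.
move=> hJ clA [a Aa] convA Lambda0 mono.
have grow v w := @monotone_gradient_lower_bound _ _ _ _ _ _ v w hJ convA mono.
apply: (@strongly_midconvex_minimizer _ _ _ _ (Lambda / 8)
          (J a - `|J' a| ^+ 2 / (2 * Lambda))) => //.
- by exists a.
- by move=> v; apply: differentiable_continuous; case: (hJ v).
- by rewrite divr_gt0.
- move=> v Av; apply: le_trans (grow _ _ Aa Av); rewrite -addrA lerD2l.
  have := inner_ge_young (J' a) (v - a) Lambda0.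
  by rewrite invfM; lra.
(* [h] has norm [`|v - w| / 2], so the quadratic term [Lambda / 2 * `|h| ^+ 2]
   is [Lambda / 8 * `|v - w| ^+ 2]. *)
- move=> v w Av Aw; pose h := 2^-1 *: (w - v); pose z := v + h.
  have Az : A z by apply: convA => //; apply/andP; split; lra.
  exists z => //; have := grow _ _ Az Av; have := grow _ _ Az Aw.
  have -> : v - z = - h by rewrite /z opprD addrA subrr add0r.
  have -> : w - z = h.
    rewrite /z opprD addrA /h -{1}[w - v]scale1r -scalerBl; congr (_ *: _); lra.
  rewrite linearN normrN distrC normrZ exprMn ger0_norm ?invr_ge0 //=; lra.
Qed.

(** * The closed ball *)

Lemma closure_ball0E (R : realType) (X : normedModType R) (M : R) (v : X) :
  0 < M -> closure (ball 0 M) v <-> `|v| <= M.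
Proof.
move=> M0; have -> : closure (ball (0 : X) M) = closed_ball 0 M by [].
by rewrite closed_ballE // /closed_ball_ /= sub0r normrN.
Qed.

Lemma closure_ball0_segment_closed (R : realType) (X : hilbertType R) (M : R) :
  0 < M -> segment_closed (closure (ball (0 : X) M)).
Proof.
move=> M0 v w t /closure_ball0E -/(_ M0) vM /closure_ball0E -/(_ M0) wM.
move=> /andP[t0 t1]; apply/closure_ball0E => //.
have -> : v + t *: (w - v) = (1 - t) *: v + t *: w.
  by rewrite scalerBr scalerBl scale1r addrCA addrC.
apply: le_trans (ler_normD _ _) _; rewrite !normrZ (ger0_norm t0).
rewrite ger0_norm ?subr_ge0 //.
have := ler_wpM2l t0 wM; have := @ler_wpM2l _ (1 - t) _ _ _ vM.
by rewrite subr_ge0 => /(_ t1); lra.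
Qed.

(** * Gradient steps near an interior minimizer *)

(** Fermat's rule on the line through [v] in the direction [h = J' v]: the
derivative there is [`|J' v| ^+ 2], so it is enough to use this one line. *)
Lemma interior_minimizer_critical (R : realType) (X : hilbertType R)
    (A : set X) (J : X -> R) (J' : X -> X) (v : X) :
  riesz_derivative J J' -> nbhs v A -> minimizer_on A J v -> J' v = 0.
Proof.
move=> hJ /nbhs_ballP[e /= e0 eA] [_ vmin].
(* The [+ 1] covers the case [h = 0]. *)
pose h := J' v; pose d := e / (`|h| + 1).
have h1 : 0 < `|h| + 1 by rewrite ltr_wpDl.
have d0 : 0 < d by rewrite divr_gt0.
have Jline t := riesz_is_derive_line v h t hJ.
have zero : is_derive (0 : R) 1 (fun s : R => J (v + s *: h)) 0.
  apply: (@derive1_at_min _ _ (- d) d) => [|t _||t].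
  - by rewrite (le_trans _ (ltW d0)) // oppr_le0 ltW.
  - by case: (Jline t).
  - by rewrite in_itv /= oppr_lt0 d0.
  - rewrite in_itv /= => td; rewrite scale0r addr0; apply/vmin/eA.
    rewrite -ball_normE /= opprD addrA subrr add0r normrN normrZ.
    have {}td : `|t| < d by rewrite ltr_norml.
    apply: le_lt_trans (_ : `|t| * (`|h| + 1) < e).
      by rewrite ler_wpM2l // lerDl.
    by rewrite -ltr_pdivlMr.
have := @derive_val _ _ _ _ _ _ _ zero.
rewrite (@derive_val _ _ _ _ _ _ _ (Jline 0)) scale0r addr0 -sqr_normE.
by move/eqP; rewrite sqrf_eq0 normr_eq0 => /eqP.
Qed.

(** Here [x] is the difference of two points and [g] that of their gradients.
Expanding [`|x - eta *: g| ^+ 2], monotonicity controls the cross term and the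
Lipschitz bound the quadratic one. *)
Lemma gradient_step_contraction (R : realType) (X : hilbertType R)
    (L Lambda eta : R) (x g : X) :
  0 <= eta -> `|g| <= L * `|x| -> Lambda * `|x| ^+ 2 <= inner g x ->
  `|x - eta *: g| ^+ 2 <= (1 - 2 * eta * Lambda + eta ^+ 2 * L ^+ 2) * `|x| ^+ 2.
Proof.
move=> eta0 lip mono.
rewrite sqr_normD normrN linearN /= innerZr normrZ exprMn ger0_norm //=.
rewrite inner_sym.
have g2 : `|g| ^+ 2 <= L ^+ 2 * `|x| ^+ 2.
  by rewrite -exprMn lerXn2r ?nnegrE // (le_trans _ lip).
have := ler_wpM2l (sqr_ge0 eta) g2; have := ler_wpM2l eta0 mono; lra.
Qed.

Theorem theorem2p2 (R : realType) (X : hilbertType R) (M : R) (hM : 0 < M)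
    (J : X -> R) (J' : X -> X) (hJ : riesz_derivative J J')
    (L Lambda : R) (hL : 0 < L) (hLambda : 0 < Lambda)
    (hLip : forall v1 v2 : X, closure (ball 0 M) v1 -> closure (ball 0 M) v2 ->
      `|J' v2 - J' v1| <= L * `|v2 - v1|)
    (hmono : forall v1 v2 : X, closure (ball 0 M) v1 -> closure (ball 0 M) v2 ->
      Lambda * `|v1 - v2| ^+ 2 <= inner (J' v1 - J' v2) (v1 - v2)) :
  (exists! vmin : X, minimizer_on (closure (ball 0 M)) J vmin) /\
  forall vmin : X, minimizer_on (closure (ball 0 M)) J vmin ->
    ball 0 M vmin ->
  forall (eta : R) (v : nat -> X),
    ball 0 M (v 0%N) ->
    ball vmin `|v 0%N - vmin| `<=` ball 0 M ->
    0 < eta < Num.min (2 * Lambda / L ^+ 2) 1 ->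
    (forall m : nat, v m.+1 = v m - eta *: J' (v m)) ->
  (exists q : R, 0 < q < 1 /\
    forall m : nat, (1 <= m)%N ->
      ball 0 M (v m) /\ `|v m - vmin| <= q ^+ (m - 1) * `|v 0%N - vmin|) /\
  v @ \oo --> vmin.
Proof.
set C := closure (ball 0 M).
have CE v : C v <-> `|v| <= M by exact: closure_ball0E.
split.
  apply: (strongly_monotone_minimizer hJ) hLambda hmono.
  - exact: closed_closure.
  - by exists 0; apply/CE; rewrite normr0 ltW.
  - exact: closure_ball0_segment_closed.
move=> vmin vminP vminM eta v v0M ballM /andP[eta0 eta1] vS.
have subC : ball 0 M `<=` C by exact: subset_closure.
have crit : J' vmin = 0.
  apply: (interior_minimizer_critical hJ) vminP.
  apply: filterS subC _; apply: open_nbhs_nbhs; split => //; exact: ball_open.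
pose k := 1 - 2 * eta * Lambda + eta ^+ 2 * L ^+ 2.
(* [k] may be zero, or even negative when [X] is trivial, whereas the rate must
   be positive: any positive number below 1 can serve as a floor for [q ^+ 2]. *)
pose q := Num.sqrt (Num.max k 4^-1).
have k1 : k < 1.
  move: eta1; rewrite lt_min ltr_pdivlMr ?exprn_gt0 // => /andP[etaL _].
  by move: etaL; rewrite -(ltr_pM2l eta0) /k; lra.
have q2 : q ^+ 2 = Num.max k 4^-1.
  by rewrite sqr_sqrtr // le_max invr_ge0 ler0n orbT.
have q0 : 0 < q by rewrite sqrtr_gt0 lt_max invr_gt0 ltr0n orbT.
have q1 : q < 1.
  by rewrite -(ltr_pXn2r (n:=2)) ?nnegrE ?(ltW q0) // q2 expr1n gt_max k1 /=; lra.
have step m : C (v m) -> `|v m.+1 - vmin| <= q * `|v m - vmin|.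
  move=> Cv; have Cmin := subC _ vminM.
  rewrite -(ler_pXn2r (n:=2)) ?nnegrE ?mulr_ge0 ?(ltW q0) //.
  rewrite vS addrAC.
  apply: le_trans (gradient_step_contraction (L := L) (Lambda := Lambda) _ _ _) _.
  - exact: ltW.
  - by have := hLip _ _ Cmin Cv; rewrite crit subr0.
  - by have := hmono _ _ Cv Cmin; rewrite crit subr0.
  - by rewrite exprMn q2 ler_wpM2r ?sqr_ge0 // le_max lexx.
have iter m : ball 0 M (v m) /\ `|v m - vmin| <= q ^+ m * `|v 0%N - vmin|.
  elim: m => [|m [vmM le_m]]; first by rewrite expr0 mul1r.
  have le_Sm : `|v m.+1 - vmin| <= q ^+ m.+1 * `|v 0%N - vmin|.
    rewrite exprS -mulrA; apply: le_trans (step _ (subC _ vmM)) _.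
    by rewrite ler_wpM2l ?(ltW q0).
  (* If [v 0 = vmin] the ball given by [ballM] is empty, but then the sequence
     is constant. *)
  split=> //; have [v0E|v0N] := eqVneq (v 0%N) vmin.
    move: le_Sm; rewrite v0E subrr normr0 mulr0 normr_le0 subr_eq0.
    by move=> /eqP ->.
  apply: ballM; rewrite -ball_normE /= distrC; apply: le_lt_trans le_Sm _.
  by rewrite gtr_pMl ?normr_gt0 ?subr_eq0 // exprn_ilt1 // ltW.
split.
  exists q; split=> [|[|m] // _]; first by rewrite q0.
  have [vM le_v] := iter m.+1; split=> //; apply: le_trans le_v _.
  by rewrite subn1 ler_wpM2r // exprS ler_piMl ?exprn_ge0 ?ltW.
apply/cvgrPdist_le => e e0.
have /cvgrPdist_le/(_ _ e0) : geometric `|v 0%N - vmin| q @ \oo --> 0.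
  by apply: cvg_geometric; rewrite ger0_norm ?ltW.
apply: filterS => m /=; rewrite sub0r normrN => small.
rewrite distrC (le_trans (iter m).2) // mulrC.
by rewrite (le_trans _ small) // ler_norm.
Qed.
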